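(* Let $X$ be a $T_2$ (Hausdorff) topological space which contains an uncountable closed discrete set. Then the product space $\omega_1 \times (\omega_1 + 1)$ embeds into $(CL(X),\tau_F)$ as a closed set; that is, there is a homeomorphism of $\omega_1 \times (\omega_1+1)$ onto a subspace of $(CL(X),\tau_F)$ which is closed in $(CL(X),\tau_F)$.
   Context: $CL(X)$ denotes the family of all nonempty closed subsets of $X$. For $M \subseteq X$ put $M^- = \{A \in CL(X): A \cap M \neq \emptyset\}$, $M^+ = \{A \in CL(X): A \subseteq M\}$ and $M^c = X \setminus M$. The Fell topology $\tau_F$ on $CL(X)$ is the topology having as a subbase the collection $\{U^-: U \text{ open in } X\} \cup \{(K^c)^+: K \text{ compact in } X\}$. The ordinals $\omega_1$ (the first uncountable ordinal) and $\omega_1+1$ carry their order topologies, and $\omega_1\times(\omega_1+1)$ carries the product topology. A closed discrete set in $X$ is a closed subset of $X$ whose subspace topology is discrete. *)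

(* Defs.v *)
From HB Require Import structures.
From mathcomp Require Import all_boot all_order all_algebra.
From mathcomp Require wochoice.
From mathcomp Require Import all_classical topology.

Set Implicit Arguments.
Unset Strict Implicit.
Unset Printing Implicit Defensive.

Import Order.TTheory.

Local Open Scope classical_set_scope.
Local Open Scope order_scope.

(* An uncountable set with a well-order supplied by the well-ordering theorem;
   [omega1] below is its initial segment of order type the first uncountable
   ordinal. *)
Definition wo_set_nat : Type := set nat.

HB.instance Definition _ := Choice.copy wo_set_nat (set nat).

Definition wo_le : rel wo_set_nat :=
  sval (wochoice.well_ordering_principle wo_set_nat).

Lemma wo_le_min (A : set wo_set_nat) : A !=set0 ->
  exists2 x, A x & forall y, A y -> wo_le x y.
Proof.
move=> [a Aa].
have [|x [[Ax minx] _]] := svalP (wochoice.well_ordering_principle wo_set_nat)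
  (mem A); first by exists a; exact/mem_set.
by exists x => [|y Ay]; [exact/set_mem | apply: minx; exact/mem_set].
Qed.

Lemma wo_le_total : total wo_le.
Proof.
move=> x y; have [|z [-> | ->] minz] := @wo_le_min [set x; y].
- by exists x; left.
- by apply/orP; left; apply: minz; right.
- by apply/orP; right; apply: minz; left.
Qed.

Lemma wo_le_refl : reflexive wo_le.
Proof. by move=> x; have := wo_le_total x x; rewrite orbb. Qed.

Lemma wo_le_anti : antisymmetric wo_le.
Proof.
move=> x y /andP[xy yx].
have [|z [_ uniqz]] := svalP (wochoice.well_ordering_principle wo_set_nat)
  (pred2 x y); first by exists x; rewrite inE eqxx.
rewrite -(uniqz x) ?(uniqz y)//; split; rewrite ?inE ?eqxx ?orbT// => t;
  by rewrite !inE => /orP[] /eqP -> //; exact: wo_le_refl.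
Qed.

Lemma wo_le_trans : transitive wo_le.
Proof.
move=> y x z xy yz.
have [|t [[-> | ->] | ->] mint] := @wo_le_min [set x; y; z].
- by exists x; left; left.
- by apply: mint; right.
- have yx : wo_le y x by apply: mint; left; left.
  by rewrite (@wo_le_anti x y) ?xy.
- have zy : wo_le z y by apply: mint; left; right.
  by rewrite (@wo_le_anti z y) ?zy.
Qed.

HB.instance Definition _ := Order.Le_isPOrder.Build (Order.Disp tt tt)
  wo_set_nat wo_le_refl wo_le_anti wo_le_trans.
HB.instance Definition _ := Order.POrder_isTotal.Build _
  wo_set_nat wo_le_total.

Definition omega1 : Type :=
  [set x : wo_set_nat | countable [set y : wo_set_nat | y < x]].

HB.instance Definition _ := SubChoice.on omega1.
HB.instance Definition _ :=
  [SubChoice_isSubOrder of omega1 by <: with Order.Disp tt tt].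

Lemma omega1_well_ordered (A : set omega1) : A !=set0 ->
  exists2 x, A x & forall y, A y -> x <= y.
Proof.
move=> [a Aa]; have [|_ [x Ax <-] minx] := @wo_le_min (val @` A).
  by exists (val a), a.
by exists x => // y Ay; rewrite leEsub; apply: minx; exists y.
Qed.

Lemma omega1_initial_countable (x : omega1) : countable [set y | y < x].
Proof.
have /countable_injP[f f_inj] := set_mem (valP x).
apply/countable_injP; exists (f \o val) => y z.
rewrite !inE /= => yx zx fyz; apply/val_inj/f_inj => //; apply: mem_set;
  [exact: yx | exact: zx].
Qed.

Lemma omega1_uncountable : ~ countable [set: omega1].
Proof.
move=> /countable_injP[f f_inj].
have countP : countable [set x : wo_set_nat | countable [set y | y < x]].
  apply/countable_injP.
  pose g x := if @idP (x \in [set x | countable [set y : wo_set_nat | y < x]])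
    is ReflectT xP then f (exist _ x xP : omega1) else 0%N.
  exists g => x y; rewrite /g.
  case: {-}_ / idP => // xP _; case: {-}_ / idP => // yP _ fxy.
  by have [] := f_inj _ _ (mem_set I) (mem_set I) fxy.
have [Pall|/existsNP[a Pa]] :=
    pselect (forall x : wo_set_nat, countable [set y | y < x]).
  have : countable [set: set nat].
    by apply: sub_countable countP; apply: subset_card_le => x _; apply: Pall.
  move=> /countable_injP[g g_inj].
  pose D := [set g B | B in [set B : set nat | ~ B (g B)]].
  have nD : ~ D (g D).
    move=> /[dup] DgD [B nB gB].
    by have DB := g_inj _ _ (mem_set I) (mem_set I) gB; rewrite DB in nB.
  by apply: (nD); exists D.
have [m Pm minm] := @wo_le_min
  [set x | ~ countable [set y : wo_set_nat | y < x]] (ex_intro _ a Pa).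
apply: Pm; apply: sub_countable countP; apply: subset_card_le => y /= ym.
apply: contrapT => /minm; rewrite -[wo_le m y]/(m <= y) => my.
by move: ym; rewrite ltNge my.
Qed.

(* [succ_ordinal T] is the order type of [T] plus one: the elements of [T] in
   their order, followed by the new greatest element [None]. *)
Definition succ_ordinal (T : Type) : Type := option T.

HB.instance Definition _ (T : choiceType) := Choice.on (succ_ordinal T).

Section SuccOrdinal.
Context {d : Order.disp_t} {T : orderType d}.

Definition succ_ordinal_le : rel (succ_ordinal T) := fun x y =>
  match x, y with
  | _, None => true
  | None, Some _ => false
  | Some a, Some b => a <= b
  end.

Lemma succ_ordinal_le_refl : reflexive succ_ordinal_le.
Proof. by case=> /=. Qed.

Lemma succ_ordinal_le_anti : antisymmetric succ_ordinal_le.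
Proof. by move=> [x|] [y|] //= /le_anti ->. Qed.

Lemma succ_ordinal_le_trans : transitive succ_ordinal_le.
Proof. by move=> [y|] [x|] [z|] //=; exact: le_trans. Qed.

Lemma succ_ordinal_le_total : total succ_ordinal_le.
Proof. by move=> [x|] [y|] //=; exact: le_total. Qed.

HB.instance Definition _ := Order.Le_isPOrder.Build d
  (succ_ordinal T) succ_ordinal_le_refl succ_ordinal_le_anti
  succ_ordinal_le_trans.
HB.instance Definition _ := Order.POrder_isTotal.Build d
  (succ_ordinal T) succ_ordinal_le_total.

End SuccOrdinal.

Definition CL (X : topologicalType) : Type :=
  [set A : set X | closed A /\ A !=set0].

HB.instance Definition _ (X : topologicalType) := SubChoice.on (CL X).

Section Fell.
Context {X : topologicalType}.

Definition hit (M : set X) : set (CL X) := [set A | val A `&` M !=set0].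

Definition inside (M : set X) : set (CL X) := [set A | val A `<=` M].

Definition fell_subbase : set (set (CL X)) :=
  [set hit U | U in open] `|` [set inside (~` K) | K in compact].

End Fell.

Definition fell (X : topologicalType) : Type := CL X.

HB.instance Definition _ (X : topologicalType) := Choice.on (fell X).
HB.instance Definition _ (X : topologicalType) :=
  isSubBaseTopological.Build (fell X) (@fell_subbase X) id.

(* In the two definitions below a set coerced to a type carries the subspace
   topology. *)
Definition closed_discrete (X : topologicalType) (D : set X) : Prop :=
  closed D /\ forall B : set D, open B.

Definition homeomorphic (S T : topologicalType) : Prop :=
  exists (f : S -> T) (g : T -> S),
    [/\ cancel f g, cancel g f, continuous f & continuous g].

Definition embeds_as_closed_set (S T : topologicalType) : Prop :=
  exists F : set T, closed F /\ homeomorphic S F.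

(* Main.v *)
Require Import Defs.
From mathcomp Require Import all_boot all_order all_algebra.
From mathcomp Require Import finmap all_classical topology.

(* The idea is to inject a two-parameter array [e b t] of points into the
   uncountable closed discrete set [D], where [b] ranges over [omega1] and [t]
   is either [None] or [Some d] with [d <= b]. The map
     (a, c) |-> {e b None : a <= b} U {e b (Some d) : a <= b, d <= b, d < c}
   is the required embedding. Since every subset of [D] is closed and compact
   sets meet [D] in finite sets, the Fell topology on the nonempty subsets of [D]
   is that of pointwise convergence, and the condition [e b t \in A] is clopen in
   (a, c) because initial segments [0, b] are clopen in an ordinal. As [a] tends
   to [omega1] the sets tend to the empty set, whatever [c] is; the empty set
   being excluded from [CL X], the image is closed. Restricting to [d <= b] makes
   each row of the array countable, so that the array can be chosen row by row by
   recursion on [b]. *)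

Set Implicit Arguments.
Unset Strict Implicit.

Import Order.TTheory.

Local Open Scope order_scope.
Local Open Scope classical_set_scope.

(** * Disjoint countable rows inside an uncountable set *)

Lemma countableU (T : Type) (A B : set T) :
  countable A -> countable B -> countable (A `|` B).
Proof.
move=> cA cB; have : countable (\bigcup_b (if b then A else B)).
  by apply: bigcup_countable => // -[].
apply: sub_countable; apply: subset_card_le => x [Ax|Bx].
  by exists true.
by exists false.
Qed.

Lemma omega1_lt_wf : well_founded (fun x y : omega1 => x < y).
Proof.
move=> a; apply: contrapT => na.
have [m nm minm] := @omega1_well_ordered
  [set x | ~ Acc (fun x y : omega1 => x < y) x]
  (ex_intro _ a na).
apply: nm; constructor => y ym; apply: contrapT => /minm.
by rewrite leNgt ym.
Qed.

(** [D] minus [C] is infinite, since otherwise [D] would lie in a union of two countable sets. *)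
Lemma countable_injects_setD (J T : Type) (B : set J) (C D : set T) :
    countable B -> countable C -> ~ countable D ->
  exists h : J -> T,
    (forall t, B t -> (D `\` C) (h t)) /\ {in B &, injective h}.
Proof.
elim/Ppointed: T => T in C D *; move=> cB cC ncD.
  by case: ncD; rewrite emptyE; exact: countable0.
have infDC : infinite_set (D `\` C).
  move=> /finite_set_countable cDC; apply: ncD.
  apply: sub_countable (countableU cC cDC); apply: subset_card_le => x Dx.
  by have [Cx|nCx] := pselect (C x); [left | right].
have /pcard_leP[f] : (B #<= D `\` C)%card.
  by apply: card_le_trans cB _; exact/infiniteP.
exists f; split => [t Bt|]; first exact: funS.
exact: inj.
Qed.

Lemma omega1_disjoint_blocks (J T : Type) (B : omega1 -> set J) (D : set T) :
    (forall a, countable (B a)) -> ~ countable D ->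
  exists e : omega1 -> J -> T, (forall a t, B a t -> D (e a t)) /\
    forall a t a' t', B a t -> B a' t' -> e a t = e a' t' -> a = a' /\ t = t'.
Proof.
move=> cB ncD.
(* The choice is made for every set, with a junk value when it is uncountable, so that the recursion
   can be set up before the used points are known to be countable. *)
have /choice[c cP] (a_C : omega1 * set T) : exists h : J -> T,
    countable a_C.2 ->
    (forall t, B a_C.1 t -> (D `\` a_C.2) (h t)) /\ {in B a_C.1 &, injective h}.
  have [cC|ncC] := pselect (countable a_C.2).
    by have [h] := countable_injects_setD (cB a_C.1) cC ncD; exists h.
  have [h _] := countable_injects_setD (cB a_C.1) (countable0 T) ncD.
  by exists h.
pose F a (rec : forall a', a' < a -> J -> T) : J -> T := c (a,
  [set x | exists a' (lt_a'a : a' < a) t, B a' t /\ rec a' lt_a'a t = x]).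
pose e := Fix omega1_lt_wf (fun=> J -> T) F.
pose used a := \bigcup_(a' in [set a' | a' < a]) (e a' @` B a').
have eE a : e a = c (a, used a).
  rewrite /e Fix_eq; last first.
    move=> b f g fg; congr (F b _).
    by apply: functional_extensionality_dep => ?; apply: funext => ?.
  congr (c (_, _)); apply/seteqP; split => x.
    by move=> [a' [aa' [t [Bt <-]]]]; exists a' => //; exists t.
  by move=> [a' aa' [t Bt <-]]; exists a', aa', t.
(* Only countably many rows precede row [a]. *)
have cused a : countable (used a).
  apply: bigcup_countable; first exact: omega1_initial_countable.
  move=> a' _; exact: card_le_trans (card_image_le _ _) (cB a').
have eP a : (forall t, B a t -> (D `\` used a) (e a t)) /\
    {in B a &, injective (e a)}.
  by rewrite eE; apply: (cP (a, used a)) (cused a).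
exists e; split => [a t /(eP a).1[]//|a t a' t' Bt Bt'].
case: (ltgtP a a') => [lt_aa' ee|lt_a'a ee|aa'].
- by have [_ []] := (eP a').1 _ Bt'; exists a => //; exists t.
- by have [_ []] := (eP a).1 _ Bt; exists a' => //; exists t'.
- by subst a'; move=> /(eP a).2 -> //; exact/mem_set.
Qed.

(** * Closed discrete sets and the Fell topology *)

Lemma closed_discrete_subset_closed (X : topologicalType) (D S : set X) :
  closed_discrete D -> S `<=` D -> closed S.
Proof.
move=> [clD discrD] SD.
(* [V] is an open set whose trace on [D] is [D] minus [S]. *)
have [V oV VE] := discrD (set_val @^-1` ~` S).
suff -> : S = D `&` ~` V by apply: closedI => //; exact: open_closedC.
have VS (x : X) (Dx : D x) : V x <-> ~ S x.
  have /(congr1 (fun B => B (SigSub (mem_set Dx)))) := VE.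
  by rewrite /preimage /= => ->.
apply/seteqP; split => [x Sx|x [Dx nVx]].
  by have Dx := SD _ Sx; split => // /(VS _ Dx).
by apply: contrapT => /(VS _ Dx).
Qed.

Lemma fell_open_hit (X : topologicalType) (U : set X) :
  open U -> open (hit U : set (fell X)).
Proof.
move=> oU; exists [set hit U]; last by rewrite bigcup_set1.
move=> _ ->; exists [fset hit U]%fset; last by rewrite set_fset1 bigcap_set1.
by move=> _ /[!inE] ->; left; exists U.
Qed.

Lemma fell_open_inside (X : topologicalType) (K : set X) :
  compact K -> open (inside (~` K) : set (fell X)).
Proof.
move=> cK; exists [set inside (~` K)]; last by rewrite bigcup_set1.
move=> _ ->; exists [fset inside (~` K)]%fset; last first.
  by rewrite set_fset1 bigcap_set1.
by move=> _ /[!inE] ->; right; exists K.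
Qed.

Lemma fell_continuous (X Y : topologicalType) (f : Y -> fell X) :
    (forall U, open U -> open (f @^-1` hit U)) ->
    (forall K, compact K -> open (f @^-1` inside (~` K))) ->
  continuous f.
Proof.
move=> fhit finside; apply/continuousP => _ [B BI <-].
rewrite preimage_bigcup; apply: bigcup_open => _ /BI[G GD <-].
rewrite preimage_bigcap openE => y Gy; rewrite /interior.
apply: filter_bigI => i Gi; apply: open_nbhs_nbhs; split; last exact: Gy.
have := GD _ Gi; rewrite inE => -[[U oU <-]|[K cK <-]]; first exact: fhit.
exact: finside.
Qed.

(** * Order topologies on well-orders *)

Lemma order_topology_continuous d (T : orderType d) (Y : topologicalType)
    (f : Y -> order_topology T) :
    (forall x, open (f @^-1` [set y | y < x])) ->
    (forall x, open (f @^-1` [set y | x < y])) ->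
  continuous f.
Proof.
move=> flt fgt; apply/continuousP => _ [B BI <-].
rewrite preimage_bigcup; apply: bigcup_open => _ /BI[G GD <-].
rewrite preimage_bigcap openE => y Gy; rewrite /interior.
apply: filter_bigI => i Gi; apply: open_nbhs_nbhs; split; last exact: Gy.
have := GD _ Gi; rewrite inE /=; case: i {Gi} => [[[]l|[]] [[]r|[]]] //= _.
- by rewrite set_itvoy; exact: fgt.
- by rewrite set_itvNyo; exact: flt.
- by rewrite set_itvNyy; exact: openT.
Qed.

(** Either [x] is maximal or it has an immediate successor [y], and then the segment is the open ray
    below [y]. *)
Lemma well_order_open_le d (T : orderType d) (x : T) :
    (forall A : set T, A !=set0 -> exists2 y, A y & forall z, A z -> y <= z) ->
  open [set y : order_topology T | y <= x].
Proof.
move=> wo; have [|xmax] := pselect ([set y | x < y] !=set0).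
  move=> /wo[y xy ymin].
  suff -> : [set z : order_topology T | z <= x] = `]-oo, y[%classic.
    exact: lray_open.
  rewrite set_itvNyo; apply/seteqP; split=> z /= zx.
    exact: le_lt_trans xy.
  by rewrite leNgt; apply/negP => /ymin; rewrite leNgt zx.
suff -> : [set y : order_topology T | y <= x] = setT by exact: openT.
apply/seteqP; split => // y _ /=; rewrite leNgt; apply/negP => xy.
by apply: xmax; exists y.
Qed.

Lemma succ_ordinal_well_ordered (T : orderType (Order.Disp tt tt)) :
    (forall A : set T, A !=set0 -> exists2 y, A y & forall z, A z -> y <= z) ->
  forall A : set (succ_ordinal T), A !=set0 ->
  exists2 y, A y & forall z, A z -> y <= z.
Proof.
move=> wo A [a Aa]; have [|A0] := pselect ((Some @^-1` A) !=set0).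
  by move=> /wo[y Ay ymin]; exists (Some y) => // -[z|] Az //; exact: ymin.
have Aeq z : A z -> z = None by case: z => // z Az; case: A0; exists z.
by exists a => // z /Aeq ->; rewrite (Aeq a).
Qed.

(** * The Fell topology over a set all of whose subsets are closed *)

(** A subset of [E] meets this open set exactly when it contains [x], so membership of a point
    becomes a hit condition. *)
Lemma setC_setD1_open (X : topologicalType) (E : set X) x :
    (forall S, S `<=` E -> closed S) ->
  open (~` (E `\ x)).
Proof. by move=> hE; apply: closed_openC; apply: hE => y []. Qed.

Lemma fell_open_notin (X : topologicalType) (x : X) :
  open [set A : fell X | ~ val A x].
Proof.
suff -> : [set A : fell X | ~ val A x] = inside (~` [set x]).
  by apply: fell_open_inside; exact: compact_set1.
apply/seteqP; split => [A nAx y Ay yx|A sub /sub]; last by apply.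
by apply: nAx; rewrite -yx.
Qed.

Section hereditarily_closed.
Context (X : topologicalType) (E : set X).
Hypothesis hE : forall S, S `<=` E -> closed S.

Lemma fell_continuous_discrete (Y : topologicalType) (f : Y -> fell X) :
    (forall y, val (f y) `<=` E) ->
    (forall x, E x -> clopen [set y | val (f y) x]) ->
  continuous f.
Proof.
move=> fE fclopen; apply: fell_continuous => [U oU|K cK].
  suff -> : f @^-1` hit U = \bigcup_(x in E `&` U) [set y | val (f y) x].
    by apply: bigcup_open => x [/fclopen[]].
  apply/seteqP; split => [y [x [fx Ux]]|y [x [Ex Ux] fx]]; last by exists x.
  by exists x => //; split=> //; exact: (fE y).
rewrite openE => y0 y0K; rewrite /interior.
(* Near-covering form of compactness: it suffices to find, for each [x] in [K], neighbourhoods of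
   [x] and of [y0] such that [f y] contains no point of the first when [y] is in the second. *)
have /compact_near_coveringP/(_ Y (nbhs y0) (fun y x => ~ val (f y) x)) := cK.
move=> near_cK; suff: \forall y \near y0, K `<=` (fun x => ~ val (f y) x).
  by apply: filterS => y Ky x fx /Ky; apply.
apply: near_cK => x Kx; have [Ex|nEx] := pselect (E x).
  (* [x] is the only point of [E] in the first set, and for [y] in the second [f y] omits it. *)
  exists (~` (E `\ x), ~` [set y | val (f y) x]) => /=.
    split; apply: open_nbhs_nbhs; split.
    - exact: setC_setD1_open.
    - by case=> _; apply.
    - by apply: closed_openC; have [] := fclopen _ Ex.
    - by move=> /y0K; apply.
  move=> [x' y] /= [xx' nfx] fx'; have Ex' := fE _ _ fx'.
  have [x'x|] := pselect (x' = x); first by apply: nfx; rewrite -x'x.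
  by move=> x'x; apply: xx'.
exists (~` E, setT) => /=.
  split; last exact: filterT.
  by apply: open_nbhs_nbhs; split => //; apply: closed_openC; exact: hE.
by move=> [x' y] /= [nEx' _] /fE.
Qed.

(** An implication with two premises. The image of the embedding will be an intersection of such
    conditions; repeating a point gives a single premise. *)
Definition closed_condition (c : X * X * X) : set (fell X) :=
  [set A | val A `<=` E /\ (val A c.1.1 -> val A c.1.2 -> val A c.2)].

(** A violating set either hits the complement of [E] or contains both premises but not the
    conclusion. The hit sets [V] express the premises faithfully only for subsets of [E]; all other
    sets violate the condition anyway. *)
Lemma fell_closed_condition c :
  E c.1.1 -> E c.1.2 -> closed (closed_condition c).
Proof.
case: c => -[x x'] y /= Ex Ex'; rewrite -openC.
pose V z := hit (~` (E `\ z)) : set (fell X).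
suff -> : ~` closed_condition (x, x', y) =
    hit (~` E) `|` (V x `&` V x' `&` [set A : fell X | ~ val A y]).
  have oV z : open (V z).
    by apply: fell_open_hit; exact: setC_setD1_open.
  apply: openU; first by apply: fell_open_hit; apply: closed_openC; exact: hE.
  by apply: openI; [exact: openI|exact: fell_open_notin].
apply/seteqP; split => [A /not_andP[/existsNP[z /not_implyP[Az nEz]]|]|A].
- by left; exists z.
- move=> /not_implyP[Ax /not_implyP[Ax' nAy]]; right; split=> //.
  by split; [exists x|exists x']; split=> //; case=> _; apply.
- case=> [[z [Az nEz]] [AE _]|]; first exact/nEz/AE.
  move=> [[[z [Az zx]] [z' [Az' zx']]] nAy] [AE imp]; apply/nAy/imp.
  + have [<-//|nzx] := pselect (z = x).
    by case: zx; split=> //; exact: AE.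
  + have [<-//|nzx'] := pselect (z' = x').
    by case: zx'; split=> //; exact: AE.
Qed.

End hereditarily_closed.

(** * Initial topologies and closed embeddings *)

(** Open sets of the initial topology cannot separate points with equal images, while rays separate
    distinct values of [h]. This reduces injectivity of the embedding to continuity of the two
    coordinates. *)
Lemma initial_order_eq d (T : orderType d) (S : choiceType)
    (Y : topologicalType) (f : S -> Y)
    (h : initial_topology f -> order_topology T) (p q : S) :
  continuous h -> f p = f q -> h p = h q.
Proof.
move=> /continuousP ch.
suff le_h p' q' : f p' = f q' -> h q' <= h p'.
  by move=> pq; apply/le_anti; rewrite !le_h.
move=> pq; rewrite leNgt; apply/negP => hpq.
have /ch[V _ VE] : open [set y : order_topology T | y < h q'].
  by rewrite -set_itvNyo; exact: lray_open.
have V_lt r : V (f r) = (h r < h q').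
  by have := congr1 (fun A => A r) VE.
by move: hpq; rewrite -V_lt pq V_lt ltxx.
Qed.

Lemma closed_embedding (S T : topologicalType) (f : S -> T) :
    injective f -> continuous f ->
    continuous (id : initial_topology f -> S) -> closed (range f) ->
  embeds_as_closed_set S T.
Proof.
move=> f_inj /continuousP cf /continuousP f_initial clf.
exists (range f); split => //.
have rf p : range f (f p) by exists p.
pose f' p : range f := SigSub (mem_set (rf p)).
have /choice[g gK] (A : range f) : exists p, f p = val A.
  by have [p _ pA] := set_mem (valP A); exists p.
exists f', g; split.
- by move=> p; apply: f_inj; rewrite gK.
- by move=> A; apply: val_inj; rewrite /= gK.
- by apply/continuousP => _ [V oV <-]; exact: cf.
- apply/continuousP => U /f_initial[V oV VE]; exists V => //.
  rewrite -[U]VE; apply/seteqP; split=> A; by rewrite /preimage /= gK.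
Qed.

(** * The staircase map and its continuity *)

Definition block (b : omega1) : set (option omega1) :=
  [set t | if t is Some d then d <= b else True].

(** [None] has two roles: as a value of [c] it is the top ordinal, as an index [t] it marks the
    entry of a row whose presence depends on [a] alone. *)
Definition below (c : succ_ordinal omega1) : set (option omega1) :=
  [set t | if t is Some d then (Some d : succ_ordinal omega1) < c else True].

Lemma countable_block b : countable (block b).
Proof.
have : countable ([set None] `|` Some @` ([set d | d < b] `|` [set b])).
  apply: countableU; first exact: countable1.
  apply: card_le_trans (card_image_le _ _) _.
  by apply: countableU; [exact: omega1_initial_countable|exact: countable1].
apply: sub_countable; apply: subset_card_le => -[d|_] /=; last by left.
rewrite le_eqVlt => /predU1P db; right; exists d => //=.
by case: db; [right|left].
Qed.

Section staircase.
Context (X : topologicalType) (e : omega1 -> option omega1 -> X).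

Definition grid : set X := [set x | exists b t, block b t /\ e b t = x].

Definition staircase (p : omega1 * succ_ordinal omega1) : set X :=
  [set x | exists b t, [/\ block b t, p.1 <= b, below p.2 t & e b t = x]].

Hypothesis hgrid : forall S, S `<=` grid -> closed S.
Hypothesis e_inj : forall b t b' t',
  block b t -> block b' t' -> e b t = e b' t' -> b = b' /\ t = t'.

Lemma staircase_subgrid p : staircase p `<=` grid.
Proof. by move=> x [b [t [? _ _ <-]]]; exists b, t. Qed.

Lemma staircaseE p b t : block b t ->
  staircase p (e b t) <-> p.1 <= b /\ below p.2 t.
Proof.
move=> bt; split => [[b' [t' [bt' pb' pt' ee]]]|[pb pt]]; last by exists b, t.
by have [<- <-] := e_inj bt' bt ee.
Qed.

Lemma staircase_CL p : closed (staircase p) /\ staircase p !=set0.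
Proof.
split; first by apply: hgrid; exact: staircase_subgrid.
by exists (e p.1 None), p.1, None.
Qed.

Local Notation domain :=
  (order_topology omega1 * order_topology (succ_ordinal omega1))%type.

Definition staircase_emb (p : domain) : fell X :=
  SigSub (mem_set (staircase_CL p)).

Let grid_e b t : block b t -> grid (e b t). Proof. by exists b, t. Qed.

Lemma staircase_clopen x : grid x -> clopen [set p : domain | staircase p x].
Proof.
move=> [b [t [bt <-]]].
have -> : [set p : domain | staircase p (e b t)] =
    (fst @^-1` [set a : order_topology omega1 | a <= b]) `&`
    (snd @^-1` [set c : order_topology (succ_ordinal omega1) | below c t]).
  by apply/seteqP; split=> p /(staircaseE p bt).
have opreim (U V : topologicalType) (f : U -> V) (A : set V) :
    continuous f -> clopen A -> clopen (f @^-1` A).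
  move=> cf [oA cA]; split; first by apply: open_comp => // ? _; exact: cf.
  by apply: closed_comp => // ? _; exact: cf.
have cfst : continuous (fst : domain -> order_topology omega1).
  by move=> ?; exact: cvg_fst.
have csnd : continuous (snd : domain -> order_topology (succ_ordinal omega1)).
  by move=> ?; exact: cvg_snd.
apply: clopenI; apply: opreim => //.
  split; first by apply: well_order_open_le; exact: omega1_well_ordered.
  by rewrite -set_itvNyc; exact: lray_closed.
case: t bt => [d|] bt; last first.
  by rewrite (_ : mkset _ = setT); [exact: clopenT|apply/seteqP].
rewrite /below /=; split; first by rewrite -set_itvoy; exact: rray_open.
rewrite -openC (_ : ~` _ =
    [set c : order_topology (succ_ordinal omega1) |
     c <= (Some d : succ_ordinal omega1)]).
  apply: well_order_open_le.
  exact/succ_ordinal_well_ordered/omega1_well_ordered.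
by apply/seteqP; split=> c /=; rewrite leNgt => /negP.
Qed.

Lemma staircase_emb_continuous : continuous staircase_emb.
Proof.
apply: (fell_continuous_discrete hgrid) => [p|x gx].
  exact: staircase_subgrid.
exact: staircase_clopen.
Qed.

(** * Closedness of the image *)

Let conditions : set (X * X * X) := [set c | [/\ grid c.1.1, grid c.1.2 &
  forall p, staircase p c.1.1 -> staircase p c.1.2 -> staircase p c.2]].

(** A nonempty set [A] obeying every implication valid in all staircases is the staircase of
    [(a, c)], where [a] is the first row with [e a None] in [A] and [c] is the first [d] occurring
    in no row, or the top if there is none. *)
Lemma range_staircase_emb :
  range staircase_emb = \bigcap_(c in conditions) closed_condition grid c.
Proof.
apply/seteqP; split => [_ [p _ <-] c [_ _ cp]|A Acond].
  by split; [exact: staircase_subgrid|exact: cp].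
have [x0 Ax0] := (set_mem (valP A)).2.
(* Any entry of row [b] forces the [None] entry of that row and of all later ones. *)
have cnone b t b' : block b t -> b <= b' ->
    conditions (e b t, e b t, e b' None).
  move=> bt bb'; split=> /=; try exact: grid_e.
  move=> p /(staircaseE p bt)[pb _] _; apply/staircaseE => //; split=> //.
  exact: le_trans bb'.
(* An entry with index [d] forces every index [d' <= d] in each row that is long enough and whose
   [None] entry is present. *)
have csome b d b' d' : d <= b -> d' <= d -> d' <= b' ->
    conditions (e b (Some d), e b' None, e b' (Some d')).
  move=> db dd' db'; split=> /=; try exact: grid_e.
  move=> p /(staircaseE p (db : block b (Some d)))[pb dp].
  move=> /(staircaseE p (I : block b' None))[pb' _].
  apply/(staircaseE p (db' : block b' (Some d'))); split=> //.
  by apply: le_lt_trans dp.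
have [b0 _] : [set: omega1] !=set0.
  by apply/set0P/eqP => omega0; apply: omega1_uncountable; rewrite omega0.
have [AE _] := Acond _ (@cnone b0 None b0 I (lexx b0)).
have close_none b t b' :
    block b t -> b <= b' -> val A (e b t) -> val A (e b' None).
  by move=> bt bb' Abt; apply: (Acond _ (cnone _ _ _ bt bb')).2.
have [a Aa amin] : exists2 a, val A (e a None) &
    forall b, val A (e b None) -> a <= b.
  apply: (@omega1_well_ordered [set a | val A (e a None)]).
  have [b [t [bt ebt]]] := AE _ Ax0; exists b; apply: (close_none b t) => //.
  by rewrite ebt.
(* [G] collects the indices occurring in [A]; by [csome] it is an initial segment of [omega1]. *)
pose G := [set d | exists b, d <= b /\ val A (e b (Some d))].
have [c cG] : exists c, forall d, G d <-> below c (Some d).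
  have [|G_full] := pselect ((~` G) !=set0); last first.
    exists None => d; split => // _; apply: contrapT => nGd; apply: G_full.
    by exists d.
  move=> /omega1_well_ordered[c nGc cmin]; exists (Some c) => d; split.
  - move=> [b [db Abd]]; rewrite /below /= ltNge; apply/negP => cd; apply: nGc.
    have {}cd : c <= d := cd.
    exists b; split; first exact: le_trans cd db.
    apply: (Acond _ (@csome b d b c db cd (le_trans cd db))).2 => //=.
    exact: close_none Abd.
  - move=> dc; apply: contrapT => /cmin; rewrite leNgt => /negP; apply.
    exact: dc.
exists (a, c) => //; apply/val_inj/seteqP; split => x /=.
- move=> [b [[d|] [/= bt ab dc <-]]]; last exact: close_none Aa.
  have [b' [db' Ab'd]] := (cG d).2 dc.
  apply: (Acond _ (@csome b' d b d db' (lexx d) bt)).2 => //=.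
  exact: close_none Aa.
- move=> Ax; have [b [t [bt ebt]]] := AE _ Ax; rewrite -ebt in Ax *.
  apply/staircaseE => //; split=> /=.
    by apply: amin; exact: close_none Ax.
  by case: t bt Ax {ebt} => [d|//] bt Ax; apply/cG; exists b.
Qed.

Lemma closed_range_staircase_emb : closed (range staircase_emb).
Proof.
rewrite range_staircase_emb; apply: closed_bigI => c [gc1 gc2 _].
exact: fell_closed_condition.
Qed.

(* The inverse of the embedding is continuous when the identity from the initial
   topology of [staircase_emb] to the product topology is. *)
Local Notation pulled := (initial_topology staircase_emb).

Let pulled_open_in b t : block b t ->
  open [set p : pulled | p.1 <= b /\ below p.2 t].
Proof.
move=> bt; exists (hit (~` (grid `\ e b t))).
  by apply: fell_open_hit; exact: setC_setD1_open.
apply/seteqP; split => [p [y [py ye]]|p /(staircaseE p bt) pe]; last first.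
  by exists (e b t); split=> // -[_]; apply.
apply/(staircaseE p bt); have [<-//|nye] := pselect (y = e b t).
by case: ye; split => //; exact: staircase_subgrid py.
Qed.

Let pulled_open_notin b t : block b t ->
  open [set p : pulled | ~ (p.1 <= b /\ below p.2 t)].
Proof.
move=> bt; exists [set A | ~ val A (e b t)]; first exact: fell_open_notin.
by apply/seteqP; split => p; apply: contra_not => /(staircaseE p bt).
Qed.

(** Row [Order.max a d] is late enough to be kept by [a] and long enough to have the index [d]. *)
Let block_max (a d : omega1) : block (Order.max a d) (Some d).
Proof. by rewrite /block /= le_max lexx orbT. Qed.

Lemma pulled_fst_continuous :
  continuous (fst : pulled -> order_topology omega1).
Proof.
apply: order_topology_continuous => x.
  (* The presence of [e b None] says exactly [p.1 <= b]; the witness in the union is [b = p.1]. *)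
  rewrite (_ : _ @^-1` _ = \bigcup_(b in [set b | b < x])
      [set p : pulled | p.1 <= b /\ below p.2 None]).
    by apply: bigcup_open => b _; exact: pulled_open_in.
  apply/seteqP; split => [p px|p [b bx [pb _]]]; last exact: le_lt_trans bx.
  by exists p.1.
rewrite (_ : _ @^-1` _ = [set p : pulled | ~ (p.1 <= x /\ below p.2 None)]).
  exact: pulled_open_notin.
apply/seteqP; split => p /=; rewrite ltNge; first by move=> /negP xp [].
by move=> npx; apply/negP => px; apply: npx.
Qed.

Lemma pulled_snd_continuous :
  continuous (snd : pulled -> order_topology (succ_ordinal omega1)).
Proof.
apply: order_topology_continuous => x.
  (* The absence of [e b (Some d)] shows [p.2 <= Some d] only if row [b] is kept, hence the
     intersection with the presence of [e b None]. *)
  rewrite (_ : _ @^-1` _ =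
      \bigcup_(bd in [set bd : omega1 * omega1 |
                      block bd.1 (Some bd.2) /\ below x (Some bd.2)])
      ([set p : pulled | p.1 <= bd.1 /\ below p.2 None] `&`
       [set p : pulled | ~ (p.1 <= bd.1 /\ below p.2 (Some bd.2))])).
    apply: bigcup_open => bd [bd_block _].
    by apply: openI; [exact: pulled_open_in|exact: pulled_open_notin].
  apply/seteqP; split => [[a [d|]] px|p [[b d] [_ dx] [[pb _] npd]]].
  - exists (Order.max a d, d); first by split; [exact: block_max|].
    split; first by rewrite /= le_max lexx.
    by move=> [_]; rewrite /below /= ltxx.
  - by move: px; rewrite /= ltNge; case: (x).
  - apply: le_lt_trans dx; rewrite leNgt; apply/negP => dp.
    exact: npd.
case: x => [d|]; last first.
  rewrite (_ : _ @^-1` _ = set0); first exact: open0.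
  by apply/seteqP; split => // p /=; rewrite ltNge; case: p.2.
rewrite (_ : _ @^-1` _ = \bigcup_(b in [set b | block b (Some d)])
    [set p : pulled | p.1 <= b /\ below p.2 (Some d)]).
  by apply: bigcup_open => b; exact: pulled_open_in.
apply/seteqP; split => [p dp|p [b _ []//]].
exists (Order.max p.1 d); first exact: block_max.
by split => //; rewrite le_max lexx.
Qed.

Lemma staircase_emb_inj : injective staircase_emb.
Proof.
move=> p q pq; rewrite (surjective_pairing p) (surjective_pairing q).
by rewrite (initial_order_eq pulled_fst_continuous pq)
  (initial_order_eq pulled_snd_continuous pq).
Qed.

Lemma staircase_closed_embedding : embeds_as_closed_set domain (fell X).
Proof.
apply: (@closed_embedding _ _ staircase_emb).
- exact: staircase_emb_inj.
- exact: staircase_emb_continuous.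
- move=> p; have cfst := @pulled_fst_continuous p.
  have csnd := @pulled_snd_continuous p.
  have := cvg_pair cfst csnd.
  have -> : (fun q : pulled => (q.1, q.2)) = id.
    by apply/funext => q; rewrite -surjective_pairing.
  by apply; exact: nbhs_filter.
- exact: closed_range_staircase_emb.
Qed.

End staircase.

Theorem theorem2p1 (X : topologicalType) (hX : hausdorff_space X)
    (hD : exists D : set X, closed_discrete D /\ ~ countable D) :
  embeds_as_closed_set
    (order_topology omega1 * order_topology (succ_ordinal omega1))%type
    (fell X).
Proof.
have [D [cdD ncD]] := hD.
have [e [eD e_inj]] := omega1_disjoint_blocks countable_block ncD.
apply: (staircase_closed_embedding (e := e)) => // S Sgrid.
apply: closed_discrete_subset_closed cdD _ => x /Sgrid[b [t [bt <-]]].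
exact: eD.
Qed.
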